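(* Let $T\in(0,\infty]$, $\varphi,\psi\in\mathbb{R}$, and let $\omega_0>0$ and $\tau_0>0$ be such that $\omega:=\sqrt{\omega_0^2-\frac{1}{4\tau_0^2}}\ge 0$. Let $\rho(t):=e^{-t/(2\tau_0)}$, $\xi(t):=\frac{\sin(\omega t)}{\omega}$ and $\eta:=\mathcal{D}\,\xi$, where $\mathcal{D}:=\frac{d}{dt}+\frac{1}{2\tau_0}\mathrm{Id}$. Moreover, let $h_1$ and $h_2$ be functions on $(0,T)$ orthogonal to $\eta$ and $\xi$, respectively, with $\langle\xi,h_1\rangle\ne0$ and $\langle\eta,h_2\rangle\neq0$. Then the oscillation $v$ satisfying $$v''+\frac{v'}{\tau_0}+\omega_0^2\,v=-\varphi\,\ell^{\varphi}-\psi\,\ell^{\psi}\ \text{ on }(0,\infty),\qquad v(0)=\varphi,\quad v'(0)=\psi,$$ stops at the time instant $T$ if $$\ell^{\varphi}:=-\frac{\rho\,h_1}{\langle\xi,h_1\rangle}\qquad\text{and}\qquad \ell^{\psi}:=\frac{\rho\,h_2}{\langle\eta,h_2\rangle}\qquad\text{on }(0,T),$$ and $\ell^\varphi(t)=\ell^\psi(t)=0$ for $t\ge T$.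
   Context: For functions $f,g:(0,T)\to\mathbb{R}$, $\langle f,g\rangle:=\int_0^T f(s)g(s)\,ds$, and $f,g$ are orthogonal if $\langle f,g\rangle=0$. For $\omega=0$, $\xi$ is understood as the limit $\xi(t)=t$. $\mathrm{Id}$ is the identity operator. A process $v$ ''stops at the time $T$'' if $v(t)=0$ for all $t\ge T$. *)

(* Defs.v *)
(* MathComp-Analysis development, over an arbitrary [R : realType]. *)
From HB Require Import structures.
From mathcomp Require Export all_boot all_order all_algebra.
From mathcomp Require Export all_classical all_reals all_analysis.

Set Implicit Arguments.
Unset Strict Implicit.
Unset Printing Implicit Defensive.

Import Order.TTheory GRing.Theory Num.Theory.
Export numFieldNormedType.Exports.

Local Open Scope classical_set_scope.
Local Open Scope ring_scope.

Section damped_oscillator.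
Context {R : realType}.
Implicit Types (T : \bar R) (f g v w : R -> R).

Local Notation mu := (@lebesgue_measure R).

(* The open interval (0, T), with T = +oo allowed. *)
Definition horizon T : set R := [set t : R | 0 < t /\ (t%:E < T)%E].

(* [Rintegral] has a junk value outside the integrable functions, so
   [has_pairing] must accompany any statement about [pairing]. *)
Definition has_pairing T f g : Prop :=
  mu.-integrable (horizon T) (EFin \o (fun s => f s * g s)).

Definition pairing T f g : R := Rintegral mu (horizon T) (fun s => f s * g s).

Definition orthogonal T f g : Prop := has_pairing T f g /\ pairing T f g = 0.

Definition omega_radicand (tau0 omega0 : R) : R := omega0 ^+ 2 - (4 * tau0 ^+ 2)^-1.

(* [Num.sqrt] vanishes on negative numbers: this is the intended frequency only
   when [0 <= omega_radicand tau0 omega0]. *)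
Definition omega (tau0 omega0 : R) : R := Num.sqrt (omega_radicand tau0 omega0).

Definition rho (tau0 : R) : R -> R := fun t => expR (- (t / (2 * tau0))).

(* For a zero frequency, the limit of [sin (w t) / w] as w tends to 0. *)
Definition xi (tau0 omega0 : R) : R -> R := fun t =>
  if omega tau0 omega0 == 0 then t
  else sin (omega tau0 omega0 * t) / omega tau0 omega0.

Definition dampD (tau0 : R) f : R -> R := fun t => derive1 f t + (2 * tau0)^-1 * f t.

Definition eta (tau0 omega0 : R) : R -> R := dampD tau0 (xi tau0 omega0).

(* Local absolute continuity on [0, +oo[ of a function w given on ]0, +oo[,
   expressed as: w is an indefinite integral of its derivative, which is
   integrable on bounded intervals. At points where w is not differentiable
   [derive1 w] has a junk value; by Lebesgue's theorem these are negligible. *)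
Definition loc_abs_continuous w : Prop :=
  (forall t, 0 < t -> mu.-integrable `]0, t[ (EFin \o derive1 w)) /\
  (forall s t, 0 < s -> s < t -> w t - w s = Rintegral mu `]s, t[ (derive1 w)).

(* Carathéodory solution of
     v'' + v' / tau0 + omega0^2 v = f on ]0, +oo[, v(0) = phi, v'(0) = psi:
   v is differentiable, v' is locally absolutely continuous and the equation
   holds almost everywhere. Classical solutions would be too restrictive, as f
   is only locally integrable and may jump. The values of v on ]-oo, 0[ are
   irrelevant; in particular v'(0) is the right derivative. *)
Definition damped_oscillation (tau0 omega0 : R) f (phi psi : R) v : Prop :=
  [/\ v 0 = phi,
      (fun e : R => e^-1 * (v e - v 0)) @ 0^'+ --> psi,
      forall t, 0 < t -> derivable v t 1,
      loc_abs_continuous (derive1 v) &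
      {ae mu, forall t, 0 < t -> derivable (derive1 v) t 1 /\
         derive1n 2 v t + derive1 v t / tau0 + omega0 ^+ 2 * v t = f t}].

(* For T = +oo there is no real t >= T, so the condition is empty. *)
Definition stops_at T v : Prop := forall t : R, (T <= t%:E)%E -> v t = 0.

End damped_oscillator.

(* Main.v *)
Require Import Defs.
From mathcomp Require Import measurable_realfun.
From mathcomp Require Import ring lra.

(** The equation is not solved: its state [(v t, v' t)] at a time [t >= T] is
    read off by testing it against solutions of the adjoint equation.  Put
    [k = 1 / (2 tau0)], let [r = omega0^2 - k^2] be the square of the frequency
    and let [y'' = - r y].  Then [W s = expR (k s) y s] solves the adjoint
    equation [W'' - W' / tau0 + omega0^2 W = 0], so that two integrations by
    parts give Green's identity ([green_identity]):

      int_0^t f W = [expR (k s) (v' y + v (k y - y'))]_0^t.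

    On the right, the value of the bracket at [0] is [- phi] for [y = xi] and
    [psi] for [y = eta], because [xi 0 = 0], [xi' 0 = eta 0 = 1] and
    [eta' 0 = k].  On the left, the factor [expR (k s)] cancels the factor [rho]
    of the controls, so that the integral is a combination of the pairings of
    [y] with [h1] and [h2] ([control_moment]); by the orthogonality and the
    normalisation it equals [phi] for [y = xi] and [- psi] for [y = eta].  Hence
    the bracket vanishes at [t] for both choices of [y].  This is a homogeneous
    linear system for [(v' t, v t)] whose determinant is [xi'^2 + r xi^2 = 1];
    so [v t = 0].

    The controls are merely such that some products with them are integrable;
    [v'] is therefore only absolutely continuous and [v''] exists only almost
    everywhere.  Integration by parts in this setting
    ([integration_by_parts_ac]) rests on a halving argument: the defect of the
    formula on an interval is additive in the interval but bounded by its length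
    times another additive quantity, hence is zero
    ([additive_quadratic_eq0]). *)

Set Implicit Arguments.
Unset Strict Implicit.
Unset Printing Implicit Defensive.
Import Order.TTheory GRing.Theory Num.Theory.
Local Open Scope classical_set_scope.
Local Open Scope ring_scope.

(** * Integration by parts for absolutely continuous functions *)

Section integrable_real.
Context d (T : measurableType d) (R : realType).
Variable mu : {measure set T -> \bar R}.
Implicit Types (D : set T) (f g : T -> R).

(** In these three lemmas the operation takes place in [R], before the injection
    into the extended reals, as in the hypotheses on [Rintegral]. *)
Lemma integrable_EFinD D f g : measurable D ->
  mu.-integrable D (EFin \o f) -> mu.-integrable D (EFin \o g) ->
  mu.-integrable D (EFin \o (fun x => f x + g x)).
Proof. by move=> mD fi gi; have := integrableD mD fi gi. Qed.

Lemma integrable_EFinZr D f (k : R) : measurable D ->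
  mu.-integrable D (EFin \o f) -> mu.-integrable D (EFin \o (fun x => f x * k)).
Proof. by move=> mD fi; have := integrableZr mD k fi. Qed.

Lemma integrable_EFinB D f g : measurable D ->
  mu.-integrable D (EFin \o f) -> mu.-integrable D (EFin \o g) ->
  mu.-integrable D (EFin \o (fun x => f x - g x)).
Proof. by move=> mD fi gi; have := integrableB mD fi gi. Qed.

End integrable_real.

Section primitives.
Context {R : realType}.
Local Notation mu := (@lebesgue_measure R).
Implicit Types (a b c d m : R) (f g F : R -> R) (E G : R -> R -> R).

Definition additive_on a b E :=
  forall c m d, a <= c -> c <= m -> m <= d -> d <= b ->
    E c d = E c m + E m d.

(** Additivity of [E] and [G] lets one cut [c, d] in two halves, which halves
    the constant [K]; iterating makes the constant arbitrarily small. *)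
Lemma additive_quadratic_eq0 a b E G (K : R) :
  additive_on a b E -> additive_on a b G ->
  (forall c d, a <= c -> c <= d -> d <= b ->
     `|E c d| <= K * (d - c) * G c d) ->
  a <= b -> E a b = 0.
Proof.
move=> addE addG leE ab.
have halving n : forall c d, a <= c -> c <= d -> d <= b ->
    2 ^+ n * `|E c d| <= K * (d - c) * G c d.
  elim: n => [|n IHn] c d ac cd db; first by rewrite expr0 mul1r leE.
  pose m := (c + d) / 2.
  have cm : c <= m by rewrite /m; lra.
  have md : m <= d by rewrite /m; lra.
  have h1 := IHn c m ac cm (le_trans md db).
  have h2 := IHn m d (le_trans ac cm) md db.
  rewrite (addG c m d)// (addE c m d)//.
  have h3 : 2 ^+ n * `|E c m + E m d| <= 2 ^+ n * (`|E c m| + `|E m d|).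
    by rewrite ler_wpM2l ?exprn_ge0// ler_normD.
  have mE1 : m - c = (d - c) / 2 by rewrite /m; field.
  have mE2 : d - m = (d - c) / 2 by rewrite /m; field.
  rewrite mE1 in h1; rewrite mE2 in h2.
  rewrite exprS -mulrA; lra.
apply/eqP; rewrite -normr_eq0 eq_le normr_ge0 andbT leNgt; apply/negP => E0.
pose X := K * (b - a) * G a b.
have [n] : exists n : nat, X / `|E a b| < n%:R.
  by exists (Num.truncn (X / `|E a b|)).+1; rewrite truncnS_gt.
rewrite ltr_pdivrMr// => Xn; have := halving n a b (lexx _) ab (lexx _).
rewrite leNgt => /negP; apply; apply: (lt_le_trans Xn).
by rewrite ler_wpM2r// -natrX ler_nat ltnW// ltn_expl.
Qed.

Lemma itv_oo_cc_integrable a b f :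
  mu.-integrable `]a, b[ (EFin \o f) -> mu.-integrable `[a, b] (EFin \o f).
Proof.
move=> /integrableP[/measurable_EFinP mf foo]; apply/integrableP; split.
  apply/measurable_EFinP/measurable_fun_itv_obnd_cbndP.
  exact/measurable_fun_itv_bndo_bndcP.
rewrite (@integral_itv_bndoo R a b _ true false)//.
by do 2 apply: measurableT_comp => //.
Qed.

Lemma Rintegral_itv_oo_cc a b f : mu.-integrable `]a, b[ (EFin \o f) ->
  \int[mu]_(x in `]a, b[) f x = \int[mu]_(x in `[a, b]) f x.
Proof.
move=> fi; rewrite /Rintegral (@integral_itv_bndoo R a b _ true false)//.
exact: measurable_int fi.
Qed.

Lemma integrable_subitv a b c d f : a <= c -> d <= b ->
  mu.-integrable `[a, b] (EFin \o f) -> mu.-integrable `[c, d] (EFin \o f).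
Proof.
by move=> ac db; apply: integrableS => //; apply: subset_itv; rewrite bnd_simp.
Qed.

Lemma Rintegral_additive a b f : mu.-integrable `[a, b] (EFin \o f) ->
  additive_on a b (fun c d => \int[mu]_(x in `[c, d]) f x).
Proof.
move=> fi c m d ac cm md db.
have fcd := integrable_subitv ac db fi.
rewrite -[X in _ + X]Rintegral_itv_obnd_cbnd; last first.
  by apply: integrableS fcd => //; apply: subset_itv; rewrite bnd_simp.
rewrite -(@Rintegral_itvB _ f (BLeft c) (BRight d) m)// ?bnd_simp//.
by rewrite addrC subrK.
Qed.

(** This is absolute continuity of [F]: at some points, [F] may fail to be
    differentiable or have a derivative other than [f]. *)
Definition is_primitive a b F f :=
  mu.-integrable `[a, b] (EFin \o f) /\
  forall c d, a <= c -> c <= d -> d <= b ->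
    F d - F c = \int[mu]_(x in `[c, d]) f x.

Lemma is_primitive_continuous a b F f : a <= b ->
  is_primitive a b F f -> {within `[a, b], continuous F}.
Proof.
move=> ab [fi Ff].
have cG := parameterized_integral_continuous ab fi.
apply: (@subspace_eq_continuous _ _ _
  (fun x => F a + parameterized_integral mu a x f)).
  move=> x; rewrite inE/= in_itv/= => /andP[ax xb].
  by rewrite /parameterized_integral -Ff// addrC subrK.
by move=> x; apply: cvgD; [exact: cvg_cst|exact: cG].
Qed.

Lemma continuous_itv_bounded a b f : a <= b -> {within `[a, b], continuous f} ->
  exists2 C, 0 <= C & forall x, a <= x <= b -> `|f x| <= C.
Proof.
move=> ab cf.
have cnf : {within `[a, b], continuous (fun x => `|f x|)}.
  move=> x; exact: (continuous_comp (cf x) (@norm_continuous _ _ _)).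
have [c cab fc] := EVT_max ab cnf.
exists `|f c| => // x xab; exact: fc.
Qed.

Lemma continuous_itv_integrable a b f :
  {within `[a, b], continuous f} -> mu.-integrable `[a, b] (EFin \o f).
Proof.
move=> cf; apply: continuous_compact_integrable => //.
exact: segment_compact.
Qed.

Lemma integrableM_continuous a b f g : a <= b ->
  mu.-integrable `[a, b] (EFin \o f) -> {within `[a, b], continuous g} ->
  mu.-integrable `[a, b] (EFin \o (fun x => f x * g x)).
Proof.
move=> ab fi cg; have [C C0 gC] := continuous_itv_bounded ab cg.
apply: (@integrableMl _ _ _ mu _ _ (EFin \o f) g) => //.
  by apply: subspace_continuous_measurable_fun.
exists C; split; first exact: num_real.
move=> M CM x /=; rewrite in_itv/= => xab.
by rewrite (le_trans (gC _ xab))// ltW.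
Qed.

Lemma derive_is_primitive a b F f : a <= b ->
  {within `[a, b], continuous F} -> {within `[a, b], continuous f} ->
  (forall x, a < x < b -> is_derive x 1 F (f x)) -> is_primitive a b F f.
Proof.
move=> ab cF cf dF; split; first exact: continuous_itv_integrable.
move=> c d ac; rewrite le_eqVlt => /predU1P[<- _|cd db].
  by rewrite subrr set_itv1 Rintegral_set1.
have sub : `[c, d] `<=` `[a, b] by apply: subset_itv; rewrite bnd_simp.
have cF' := continuous_subspaceW sub cF.
have cf' := continuous_subspaceW sub cf.
have dF' x : x \in `]c, d[ -> is_derive x 1 F (f x).
  rewrite in_itv/= => /andP[cx xd]; apply: dF.
  by rewrite (le_lt_trans ac cx) (lt_le_trans xd db).
rewrite /Rintegral (continuous_FTC2 cd cf' (F := F))//.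
  have /(continuous_within_itvP _ cd)[_ ? ?] := cF'.
  by split => // x xcd; have [] := dF' x xcd.
by move=> x xcd; rewrite derive1E; have [_ ->] := dF' x xcd.
Qed.

Lemma primitive_oscillation a b F f c d x y : is_primitive a b F f ->
  a <= c -> d <= b -> c <= x <= d -> c <= y <= d ->
  `|F x - F y| <= \int[mu]_(r in `[c, d]) `|f r|.
Proof.
move=> [fi Ff] ac db.
wlog yx : x y / y <= x.
  move=> H xcd ycd; have [xy|/ltW yx] := leP x y; last exact: H.
  by rewrite distrC; exact: H.
move=> /andP[cx xd] /andP[cy yd].
rewrite Ff// ?(le_trans ac)// ?(le_trans xd)//.
have fi' := integrable_subitv (le_trans ac cy) (le_trans xd db) fi.
have ni := integrable_norm (integrable_subitv ac db fi).
apply: (le_trans (le_normr_Rintegral _ fi')) => //.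
have cd : c <= d := le_trans cx xd.
have addN := Rintegral_additive ni.
rewrite (addN c y d)// (addN y x d)//.
have I0 u w : 0 <= \int[mu]_(r in `[u, w]) `|f r| by apply: Rintegral_ge0.
by rewrite addrA addrAC lerDr addr_ge0.
Qed.

(** Over [c, d] the defect of the formula is the integral of
    [- p (W d - W x) + w (P x - P c)].  Both differences are oscillations on
    [c, d]: that of [W] is at most [C (d - c)] with [C] a bound of [w], that of
    [P] at most the integral [G] of [|p|].  So the defect is at most
    [2 C (d - c) G]. *)
Theorem integration_by_parts_ac a b P p W w : a <= b ->
  is_primitive a b P p -> is_primitive a b W w ->
  {within `[a, b], continuous w} ->
  \int[mu]_(x in `[a, b]) (p x * W x + P x * w x) = P b * W b - P a * W a.
Proof.
move=> ab Pp Ww cw.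
have cP := is_primitive_continuous ab Pp.
have cW := is_primitive_continuous ab Ww.
have [C C0 wC] := continuous_itv_bounded ab cw.
have [pi Pint] := Pp; have [wi Wint] := Ww.
pose h x := p x * W x + P x * w x.
have ipW := integrableM_continuous ab pi cW.
have iPw : mu.-integrable `[a, b] (EFin \o (fun x => P x * w x)).
  by apply: integrableM_continuous => //; exact: continuous_itv_integrable.
have hi : mu.-integrable `[a, b] (EFin \o h) by exact: integrable_EFinD.
pose E c d := \int[mu]_(x in `[c, d]) h x - (P d * W d - P c * W c).
suff : E a b = 0 by move/eqP; rewrite subr_eq0 => /eqP.
have np := integrable_norm pi.
apply: (@additive_quadratic_eq0 a b E
  (fun c d => \int[mu]_(x in `[c, d]) `|p x|) (2 * C)) => //.
- move=> c m d ac cm md db; rewrite /E (Rintegral_additive hi ac cm md db).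
  ring.
- exact: Rintegral_additive.
move=> c d ac cd db.
have restr f : mu.-integrable `[a, b] (EFin \o f) ->
  mu.-integrable `[c, d] (EFin \o f) := integrable_subitv ac db.
set G := (X in _ <= _ * X).
have pcd := restr _ pi; have wcd := restr _ wi; have hcd := restr _ hi.
have i1 : mu.-integrable `[c, d] (EFin \o (fun x => p x * W d)).
  exact: integrable_EFinZr.
have i2 : mu.-integrable `[c, d] (EFin \o (fun x => w x * P c)).
  exact: integrable_EFinZr.
have i12 : mu.-integrable `[c, d] (EFin \o (fun x => p x * W d + w x * P c)).
  exact: integrable_EFinD.
have idiff : mu.-integrable `[c, d]
    (EFin \o (fun x => h x - (p x * W d + w x * P c))).
  exact: integrable_EFinB.
have lenE : fine (mu `[c, d]) = d - c.
  by rewrite lebesgue_measure_itv/= lte_fin; case: ltP => //= dc;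
     rewrite (@le_anti _ _ c d) ?cd// subrr.
have -> : E c d = \int[mu]_(x in `[c, d]) (h x - (p x * W d + w x * P c)).
  rewrite RintegralB// [X in _ = _ - X]RintegralD// !RintegralZr//.
  rewrite -Pint// -Wint// /E; ring.
have G0 : 0 <= G by apply: Rintegral_ge0.
have oscW x : c <= x <= d -> `|W d - W x| <= C * (d - c).
  move=> xcd; have dcd : c <= d <= d by rewrite cd lexx.
  apply: (le_trans (primitive_oscillation Ww ac db dcd xcd)).
  have -> : C * (d - c) = \int[mu]_(x in `[c, d]) C.
    by rewrite Rintegral_cst// lenE.
  apply: le_Rintegral => //; first exact: (integrable_norm (restr _ wi)).
    by apply: continuous_itv_integrable => ?; exact: cvg_cst.
  move=> z /=; rewrite in_itv/= => /andP[cz zd]; apply: wC.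
  by rewrite (le_trans ac cz) (le_trans zd db).
have oscP x : c <= x <= d -> `|P x - P c| <= G.
  by move=> xcd; apply: (primitive_oscillation Pp ac db xcd); rewrite lexx.
have iC : mu.-integrable `[c, d] (EFin \o (fun=> C * G)).
  by apply: continuous_itv_integrable => ?; exact: cvg_cst.
have iB : mu.-integrable `[c, d] (EFin \o (fun x => `|p x| * (C * (d - c)))).
  by apply: integrable_EFinZr => //; exact: restr.
apply: (le_trans (le_normr_Rintegral _ idiff)) => //.
apply: (@le_trans _ _
    (\int[mu]_(x in `[c, d]) (`|p x| * (C * (d - c)) + C * G))).
  apply: le_Rintegral => //; first exact: (integrable_norm idiff).
    exact: integrable_EFinD.
  move=> x /=; rewrite in_itv/= => xcd.
  have -> : h x - (p x * W d + w x * P c) =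
      - (p x * (W d - W x)) + w x * (P x - P c) by rewrite /h; ring.
  rewrite (le_trans (ler_normD _ _))// normrN !normrM lerD//.
    by rewrite ler_wpM2l// oscW.
  rewrite ler_pM// ?oscP//; apply: wC.
  by case/andP: xcd => cx xd; rewrite (le_trans ac cx) (le_trans xd db).
rewrite RintegralD// RintegralZr//; last exact: restr.
rewrite Rintegral_cst// lenE -/G; lra.
Qed.

End primitives.

(** * Green's identity for the damped oscillator *)

Section oscillator.
Context {R : realType}.
Local Notation mu := (@lebesgue_measure R).
Implicit Types (t : R) (f v y : R -> R).

(** For a solution [v], [derive1 v] is meaningful on ]0, +oo[ only; its value at
    [0] has to be replaced by the initial velocity. *)
Definition extend_at0 (c : R) f : R -> R := fun r => if r <= 0 then c else f r.

Lemma extend_at0_pos c f r : 0 < r -> extend_at0 c f r = f r.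
Proof. by rewrite /extend_at0; case: ltP. Qed.

Lemma extend_at0_0 c f : extend_at0 c f 0 = c.
Proof. by rewrite /extend_at0 lexx. Qed.

Lemma cvg_quotient_right_continuous v (psi : R) :
  (fun e : R => e^-1 * (v e - v 0)) @ 0^'+ --> psi -> v @ 0^'+ --> v 0.
Proof.
move=> quot.
have id0 : (fun e : R => e) @ 0^'+ --> (0 : R).
  by apply: cvg_at_right_filter => //.
have vlim : (fun e => v 0 + e * (e^-1 * (v e - v 0))) @ 0^'+ --> v 0 + 0 * psi.
  by apply: cvgD; [exact: cvg_cst|exact: cvgM].
rewrite mul0r addr0 in vlim; apply: cvg_trans vlim; apply: near_eq_cvg.
near=> e; have e0 : e != 0 by near: e; exact: nbhs_right_neq.
by rewrite /= mulrA mulfV// mul1r addrC subrK.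
Unshelve. all: by end_near. Qed.

(** As [derive1 p] is integrable up to [0], [p] has a right limit [L] at [0],
    and the extension by this limit is an indefinite integral on all of
    [0, t]. *)
Lemma loc_abs_continuous_trace p t : 0 < t -> loc_abs_continuous p ->
  exists L, is_primitive 0 t (extend_at0 L p) (derive1 p).
Proof.
move=> t0 [pi pint]; have qi := itv_oo_cc_integrable (pi t t0).
pose G r := \int[mu]_(x in `[0, r]) derive1 p x.
have G0 : G 0 = 0 by rewrite /G set_itv1 Rintegral_set1.
have addG := Rintegral_additive qi.
exists (p t - G t).
have pE r : 0 <= r -> r <= t -> extend_at0 (p t - G t) p r = p t - G t + G r.
  rewrite le_eqVlt => /predU1P[<-|r0] rt.
    by rewrite extend_at0_0 G0 addr0.
  rewrite extend_at0_pos//; move: rt; rewrite le_eqVlt => /predU1P[->|rt].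
    by rewrite subrK.
  have := addG 0 r t (lexx _) (ltW r0) (ltW rt) (lexx _).
  rewrite -/(G t) -/(G r) -Rintegral_itv_oo_cc; last first.
    apply: integrableS (pi t t0) => //.
    by apply: subset_itv; rewrite bnd_simp// ltW.
  rewrite -pint// => ->; ring.
split => // c d c0 cd dt.
rewrite !pE ?(le_trans c0)// ?(le_trans cd)//.
rewrite /G (addG 0 c d)//; ring.
Qed.

(** By the mean value theorem the difference quotients at [0] are values of the
    derivative at points closer to [0], so both have the same limit. *)
Lemma right_derivative_trace v (psi L : R) t : 0 < t ->
  (forall x, 0 < x -> derivable v x 1) ->
  (fun e : R => e^-1 * (v e - v 0)) @ 0^'+ --> psi ->
  {within `[0, t], continuous (extend_at0 L (derive1 v))} ->
  L = psi.
Proof.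
move=> t0 dv quot /(continuous_within_itvP _ t0)[_ + _].
rewrite extend_at0_0 => pL.
have cv := cvg_quotient_right_continuous quot.
suff : (fun e : R => e^-1 * (v e - v 0)) @ 0^'+ --> L.
  by move=> quotL; exact: (cvg_unique _ quotL quot).
apply/cvgrPdist_lt => eps eps0.
have /cvgrPdist_lt/(_ _ eps0)[d /= d0 pLd] := pL.
near=> e.
have e0 : 0 < e by near: e; exact: nbhs_right_gt.
have ed : e < d by near: e; exact: nbhs_right_lt.
have [||c c0e ->] := @MVT R v (derive1 v) 0 e e0.
- move=> x; rewrite in_itv/= => /andP[x0 _]; apply: DeriveDef; first exact: dv.
  by rewrite derive1E.
- apply/(continuous_within_itvP _ e0); split => //.
    move=> x; rewrite in_itv/= => /andP[x0 _].
    by apply: differentiable_continuous; apply/derivable1_diffP; exact: dv.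
  apply: cvg_at_left_filter.
  by apply: differentiable_continuous; apply/derivable1_diffP; exact: dv.
rewrite subr0 mulrC mulfK ?gt_eqF//.
move: c0e; rewrite in_itv/= => /andP[c0 ce].
rewrite -(extend_at0_pos L (derive1 v) c0); apply: pLd => //=.
by rewrite sub0r normrN gtr0_norm// (lt_trans ce).
Unshelve. all: by end_near. Qed.

Lemma damped_oscillation_primitives (tau0 omega0 phi psi : R) f v t : 0 < t ->
  damped_oscillation tau0 omega0 f phi psi v ->
  is_primitive 0 t v (extend_at0 psi (derive1 v)) /\
  is_primitive 0 t (extend_at0 psi (derive1 v)) (derive1 (derive1 v)).
Proof.
move=> t0 [_ quot dv acp _].
have [L pL] := loc_abs_continuous_trace t0 acp.
have cL := is_primitive_continuous (ltW t0) pL.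
have Lpsi := right_derivative_trace t0 dv quot cL.
rewrite -Lpsi; split => //.
apply: derive_is_primitive => //; first exact: ltW.
  apply/(continuous_within_itvP _ t0); split.
  - move=> x; rewrite in_itv/= => /andP[x0 _].
    by apply: differentiable_continuous; apply/derivable1_diffP; exact: dv.
  - exact: cvg_quotient_right_continuous quot.
  - apply: cvg_at_left_filter.
    by apply: differentiable_continuous; apply/derivable1_diffP; exact: dv.
move=> x /andP[x0 _]; rewrite extend_at0_pos//.
by apply: DeriveDef; [exact: dv|rewrite derive1E].
Qed.

Lemma is_derive_scaled (f : R -> R) (c x df : R) : is_derive (c * x) 1 f df ->
  is_derive x 1 (fun s => f (c * s)) (df * c).
Proof.
move=> dfx; have d1 : is_derive x 1 (fun s : R => c * s) c.
  have := is_deriveZ c (is_derive_id x (1 : R)).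
  by rewrite /GRing.scale/= mulr1.
exact: (is_derive1_comp dfx d1).
Qed.

Lemma is_derive_expM (k : R) f (x df : R) : is_derive x 1 f df ->
  is_derive x 1 (fun s => expR (k * s) * f s) (expR (k * x) * (df + k * f x)).
Proof.
move=> dfx.
have de := is_derive_scaled (is_derive_expR (k * x)).
apply: is_derive_eq (is_deriveM de dfx) _.
by rewrite /GRing.scale/=; ring.
Qed.

Lemma is_derive_continuous_itv (F f : R -> R) (a b : R) :
  (forall x : R, is_derive x 1 F (f x)) -> {within `[a, b], continuous F}.
Proof.
by move=> dF; apply: derivable_within_continuous => x _; have [] := dF x.
Qed.

(** With [W = expR (k s) y] and [Z = expR (k s) (k y - y')] one has
    [W' + Z = W / tau0] and [Z' = omega0^2 W].  Integrating by parts the pairs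
    [(v', W)] and [(v, Z)] therefore produces together
    [(v'' + v' / tau0 + omega0^2 v) W]. *)
Lemma green_identity (tau0 omega0 phi psi : R) f v t y y' :
  0 < t -> tau0 != 0 ->
  (forall x : R, is_derive x 1 y (y' x)) ->
  (forall x : R, is_derive x 1 y' (- omega_radicand tau0 omega0 * y x)) ->
  damped_oscillation tau0 omega0 f phi psi v ->
  let k := (2 * tau0)^-1 in
  measurable_fun `]0, t[ (fun s => f s * (expR (k * s) * y s)) ->
  \int[mu]_(s in `]0, t[) (f s * (expR (k * s) * y s)) =
    expR (k * t) * (derive1 v t * y t + v t * (k * y t - y' t))
    - (psi * y 0 + phi * (k * y 0 - y' 0)).
Proof.
move=> t0 tau0N0 dy dy' sol k.
set W := fun s => expR (k * s) * y s => mfW.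
pose w s := expR (k * s) * (y' s + k * y s).
pose Z s := expR (k * s) * (k * y s - y' s).
pose z s := omega0 ^+ 2 * W s.
have t0' := ltW t0.
have dW (x : R) : is_derive x 1 W (w x) by exact: is_derive_expM.
have dw (x : R) : is_derive x 1 w (expR (k * x) *
    (- omega_radicand tau0 omega0 * y x + k * y' x + k * (y' x + k * y x))).
  apply: is_derive_expM; apply: is_deriveD; exact: (is_deriveZ k (dy x)).
have dZ (x : R) : is_derive x 1 Z (z x).
  have dky : is_derive x 1 (fun s => k * y s - y' s)
      (k * y' x - - omega_radicand tau0 omega0 * y x).
    by apply: is_deriveB; exact: (is_deriveZ k (dy x)).
  apply: is_derive_eq (is_derive_expM k dky) _.
  by rewrite /z /W /omega_radicand /k; field.
have cW := is_derive_continuous_itv (a := 0) (b := t) dW.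
have cw := is_derive_continuous_itv (a := 0) (b := t) dw.
have cZ := is_derive_continuous_itv (a := 0) (b := t) dZ.
have cz : {within `[0, t], continuous z}.
  by move=> x; apply: cvgM; [exact: cvg_cst|exact: cW].
have pW : is_primitive 0 t W w by apply: derive_is_primitive.
have pZ : is_primitive 0 t Z z by apply: derive_is_primitive.
have [pv pp] := damped_oscillation_primitives t0 sol.
set p := extend_at0 psi (derive1 v) in pv pp.
have ibp1 := integration_by_parts_ac t0' pp pW cw.
have ibp2 := integration_by_parts_ac t0' pv pZ cz.
have cv := is_primitive_continuous t0' pv.
have cp := is_primitive_continuous t0' pp.
have [qi _] := pp; have [pi _] := pv.
have vi := continuous_itv_integrable cv.
pose q := derive1 (derive1 v).
pose g s := (q s * W s + p s * w s) + (p s * Z s + v s * z s).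
have i1 : mu.-integrable `[0, t] (EFin \o (fun s => q s * W s + p s * w s)).
  by apply: integrable_EFinD => //; exact: integrableM_continuous.
have i2 : mu.-integrable `[0, t] (EFin \o (fun s => p s * Z s + v s * z s)).
  by apply: integrable_EFinD => //; exact: integrableM_continuous.
have gi : mu.-integrable `[0, t] (EFin \o g) by exact: integrable_EFinD.
have gint : \int[mu]_(s in `[0, t]) g s =
    p t * W t - p 0 * W 0 + (v t * Z t - v 0 * Z 0).
  by rewrite RintegralD// ibp1 ibp2.
have gio : mu.-integrable `]0, t[ (EFin \o g).
  by apply: integrableS gi => //; exact: subset_itv_oo_cc.
(* The equation turns [f W] into [g] at almost every time: the terms in
   [expR (k s) y'] cancel in [w + Z = W / tau0]. *)
have -> : \int[mu]_(s in `]0, t[) (f s * W s) = \int[mu]_(s in `]0, t[) g s.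
  rewrite /Rintegral; congr fine; apply: ae_eq_integral => //.
  - exact/measurable_EFinP.
  - exact: measurable_int gio.
  have [_ _ _ _ [N [mN N0 subN]]] := sol.
  exists N; split => //; apply: subset_trans subN; apply: subsetC => s odes /=.
  rewrite in_itv/= => /andP[s0 st].
  have [_ <-] := odes s0.
  rewrite /g /p extend_at0_pos// /w /z /W /q /derive1n/= /Z; congr EFin.
  by rewrite /k; field.
rewrite Rintegral_itv_oo_cc// gint /p extend_at0_pos// extend_at0_0.
have [-> _ _ _ _] := sol.
rewrite /W /Z !mulr0 expR0; ring.
Qed.

End oscillator.

(** * The fundamental system and the moments of the controls *)

Section fundamental_system.
Context {R : realType} (tau0 omega0 : R).
Local Notation om := (omega tau0 omega0).
Local Notation xi := (xi tau0 omega0).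
Local Notation eta := (eta tau0 omega0).
Local Notation k := (2 * tau0)^-1.

Lemma is_derive_xi (x : R) : is_derive x 1 xi (cos (om * x)).
Proof.
have [om0|omN0] := eqVneq om 0.
  have -> : xi = id by apply/funext => s; rewrite /Defs.xi om0 eqxx.
  by rewrite om0 mul0r cos0; exact: is_derive_id.
have -> : xi = om^-1 \*: (fun s => sin (om * s)).
  by apply/funext => s; rewrite /Defs.xi (negbTE omN0) mulrC.
have ds := is_derive_scaled (is_derive_sin (om * x)).
apply: is_derive_eq (is_deriveZ om^-1 ds) _.
by rewrite /GRing.scale/=; field.
Qed.

Lemma sinE_xi (x : R) : sin (om * x) = om * xi x.
Proof.
rewrite /Defs.xi; case: eqVneq => [->|omN0]; first by rewrite !mul0r sin0.
by rewrite [RHS]mulrC divfK.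
Qed.

Lemma is_derive_cos_om (x : R) : 0 <= omega_radicand tau0 omega0 ->
  is_derive x 1 (fun s => cos (om * s)) (- omega_radicand tau0 omega0 * xi x).
Proof.
move=> rad0; apply: is_derive_eq (is_derive_scaled (is_derive_cos (om * x))) _.
by rewrite sinE_xi -(sqr_sqrtr rad0) -/om; ring.
Qed.

Lemma cos_xi_pythagoras (x : R) : 0 <= omega_radicand tau0 omega0 ->
  cos (om * x) ^+ 2 + omega_radicand tau0 omega0 * xi x ^+ 2 = 1.
Proof.
move=> rad0; rewrite -(cos2Dsin2 (om * x)) sinE_xi -{1}(sqr_sqrtr rad0) -/om.
by ring.
Qed.

Lemma etaE (x : R) : eta x = cos (om * x) + k * xi x.
Proof.
rewrite /Defs.eta /dampD derive1E.
by have [_ ->] := is_derive_xi x.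
Qed.

Lemma is_derive_eta (x : R) : 0 <= omega_radicand tau0 omega0 ->
  is_derive x 1 eta (- omega_radicand tau0 omega0 * xi x + k * cos (om * x)).
Proof.
move=> rad0.
have -> : eta = (fun s => cos (om * s)) + k \*: xi.
  by apply/funext => s; rewrite etaE.
apply: is_deriveD; first exact: is_derive_cos_om.
exact: (is_deriveZ k (is_derive_xi x)).
Qed.

Lemma xi0 : xi 0 = 0.
Proof. by rewrite /Defs.xi mulr0 sin0 mul0r if_same. Qed.

End fundamental_system.

Section pairing.
Context {R : realType}.
Local Notation mu := (@lebesgue_measure R).
Implicit Types (f g F : R -> R).

Lemma pairingC (T : \bar R) f g : pairing T f g = pairing T g f.
Proof. by apply: eq_Rintegral => s _; rewrite mulrC. Qed.

Lemma has_pairingC (T : \bar R) f g : has_pairing T f g -> has_pairing T g f.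
Proof.
rewrite /has_pairing; congr (is_true (integrable _ _ _)).
by apply/funext => s /=; rewrite mulrC.
Qed.

Lemma horizon_fin (t : R) : horizon t%:E = `]0, t[%classic.
Proof.
apply/seteqP; split => s; rewrite /horizon /= in_itv/= lte_fin.
  by move=> [-> ->].
by move=> /andP[].
Qed.

Lemma Rintegral_supported (T0 t : R) F g : T0 <= t ->
  (forall s, 0 < s -> s < T0 -> F s = g s) ->
  (forall s, T0 <= s -> F s = 0) ->
  mu.-integrable `]0, T0[ (EFin \o g) ->
  mu.-integrable `]0, t[ (EFin \o F) /\
  \int[mu]_(s in `]0, t[) F s = \int[mu]_(s in `]0, T0[) g s.
Proof.
move=> T0t Fin Fout gi.
have FE : {in `]0, t[%classic, F =1 g \_ `]0, T0[}.
  move=> s; rewrite inE/= in_itv/= => /andP[s0 st]; rewrite patchE.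
  case: ifPn => [|].
    by rewrite inE/= in_itv/= => /andP[_ sT]; rewrite Fin.
  by rewrite notin_setE/= in_itv/= s0/= => /negP; rewrite -leNgt => /Fout.
have II : `]0, t[ `&` `]0, T0[ = `]0, T0[%classic.
  by apply: setIidr; apply: subset_itv; rewrite bnd_simp.
split.
  apply: (@eq_integrable _ _ _ mu _ _ (EFin \o (g \_ `]0, T0[))) => //.
    by move=> s st /=; rewrite FE.
  by rewrite -restrict_EFin; apply/integrable_restrict => //=; rewrite II.
by rewrite -[in RHS]II Rintegral_mkcondr; exact: eq_Rintegral.
Qed.

(** Since [rho] is the inverse of [s |-> expR (k s)], the damping disappears
    from the integrals that occur in Green's identity; the constants [A] and [B]
    stand for the two normalising pairings. *)
Lemma control_moment (T0 t phi psi tau0 A B : R) (h1 h2 lphi lpsi y : R -> R) :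
  T0 <= t ->
  (forall s, 0 < s -> s < T0 -> lphi s = - (rho tau0 s * h1 s / A)) ->
  (forall s, 0 < s -> s < T0 -> lpsi s = rho tau0 s * h2 s / B) ->
  (forall s, T0 <= s -> lphi s = 0) ->
  (forall s, T0 <= s -> lpsi s = 0) ->
  has_pairing T0%:E y h1 -> has_pairing T0%:E y h2 ->
  let F s := (- (phi * lphi s) - psi * lpsi s) *
             (expR ((2 * tau0)^-1 * s) * y s) in
  mu.-integrable `]0, t[ (EFin \o F) /\
  \int[mu]_(s in `]0, t[) F s =
    phi / A * pairing T0%:E y h1 - psi / B * pairing T0%:E y h2.
Proof.
rewrite /has_pairing /pairing horizon_fin => T0t.
move=> lphi_in lpsi_in lphi_out lpsi_out i1 i2.
set F := fun s : R => (- (phi * lphi s) - _) * _.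
have j1 : mu.-integrable `]0, T0[ (EFin \o (fun s => y s * h1 s * (phi / A))).
  by apply: integrable_EFinZr => //.
have j2 : mu.-integrable `]0, T0[ (EFin \o (fun s => y s * h2 s * (psi / B))).
  by apply: integrable_EFinZr => //.
have j12 : mu.-integrable `]0, T0[
    (EFin \o (fun s => y s * h1 s * (phi / A) - y s * h2 s * (psi / B))).
  exact: integrable_EFinB.
have [||Fi ->] := Rintegral_supported (F := F) T0t _ _ j12.
- move=> s s0 sT; rewrite /F lphi_in// lpsi_in//.
  have rhoK : rho tau0 s * expR ((2 * tau0)^-1 * s) = 1.
    by rewrite /rho mulrC [s / _]mulrC -expRD subrr expR0.
  rewrite (_ : - _ - _ = rho tau0 s * (h1 s * (phi / A) - h2 s * (psi / B)));
    last by ring.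
  by rewrite mulrACA rhoK; ring.
- by move=> s sT; rewrite /F lphi_out// lpsi_out// !mulr0 subr0 oppr0 mul0r.
split => //; rewrite RintegralB// !RintegralZr//; ring.
Qed.

End pairing.

Theorem corollary4 (R : realType) (T : \bar R) (phi psi omega0 tau0 : R)
    (h1 h2 lphi lpsi v : R -> R)
    (T_gt0 : (0 < T)%E) (omega0_gt0 : 0 < omega0) (tau0_gt0 : 0 < tau0)
    (omega_ge0 : 0 <= omega_radicand tau0 omega0)
    (h1_eta : orthogonal T h1 (eta tau0 omega0))
    (h2_xi : orthogonal T h2 (xi tau0 omega0))
    (xi_h1 : has_pairing T (xi tau0 omega0) h1)
    (xi_h1_neq0 : pairing T (xi tau0 omega0) h1 <> 0)
    (eta_h2 : has_pairing T (eta tau0 omega0) h2)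
    (eta_h2_neq0 : pairing T (eta tau0 omega0) h2 <> 0)
    (v_sol : damped_oscillation tau0 omega0
               (fun t => - (phi * lphi t) - psi * lpsi t) phi psi v)
    (lphi_in : forall t : R, 0 < t -> (t%:E < T)%E ->
       lphi t = - (rho tau0 t * h1 t / pairing T (xi tau0 omega0) h1))
    (lpsi_in : forall t : R, 0 < t -> (t%:E < T)%E ->
       lpsi t = rho tau0 t * h2 t / pairing T (eta tau0 omega0) h2)
    (lphi_out : forall t : R, (T <= t%:E)%E -> lphi t = 0)
    (lpsi_out : forall t : R, (T <= t%:E)%E -> lpsi t = 0) :
  stops_at T v.
Proof.
move=> t Tt.
case: T => [T0| |] in T_gt0 h1_eta h2_xi xi_h1 xi_h1_neq0 eta_h2 eta_h2_neq0
  lphi_in lpsi_in lphi_out lpsi_out Tt *; last 2 first.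
- by rewrite leye_eq in Tt.
- by rewrite ltNge leNye in T_gt0.
rewrite lte_fin in T_gt0; rewrite lee_fin in Tt.
have t0 : 0 < t := lt_le_trans T_gt0 Tt.
have tau0N0 : tau0 != 0 by rewrite gt_eqF.
have [h1_eta_ex h1_eta0] := h1_eta; have [h2_xi_ex h2_xi0] := h2_xi.
rewrite pairingC in h1_eta0; rewrite pairingC in h2_xi0.
have moment y (y_h1 : has_pairing T0%:E y h1) (y_h2 : has_pairing T0%:E y h2) :=
  @control_moment R T0 t phi psi tau0 _ _ h1 h2 lphi lpsi y Tt
    lphi_in lpsi_in lphi_out lpsi_out y_h1 y_h2.
have [/measurable_int mxi moment_xi] := moment _ xi_h1 (has_pairingC h2_xi_ex).
have [/measurable_int meta moment_eta] :=
  moment _ (has_pairingC h1_eta_ex) eta_h2.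
have green_xi := green_identity t0 tau0N0 (is_derive_xi tau0 omega0)
  (fun x => is_derive_cos_om x omega_ge0) v_sol.
have d2eta (x : R) : is_derive x 1
    (fun s => - omega_radicand tau0 omega0 * xi tau0 omega0 s
              + (2 * tau0)^-1 * cos (omega tau0 omega0 * s))
    (- omega_radicand tau0 omega0 * eta tau0 omega0 x).
  apply: is_derive_eq (is_deriveD
    (is_deriveZ (- omega_radicand tau0 omega0) (is_derive_xi tau0 omega0 x))
    (is_deriveZ (2 * tau0)^-1 (is_derive_cos_om x omega_ge0))) _.
  by rewrite etaE /GRing.scale/=; ring.
have green_eta := green_identity t0 tau0N0
  (fun x => is_derive_eta x omega_ge0) d2eta v_sol.
have pyth := cos_xi_pythagoras t omega_ge0.
have exp_neq0 : expR ((2 * tau0)^-1 * t) != 0 by rewrite gt_eqF ?expR_gt0.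
(* The bracket of Green's identity vanishes at [t], first for [y = xi], then
   for [y = eta]. *)
have {green_xi} : derive1 v t * xi tau0 omega0 t +
    v t * ((2 * tau0)^-1 * xi tau0 omega0 t - cos (omega tau0 omega0 * t)) = 0.
  apply: (mulfI exp_neq0); rewrite mulr0.
  have := green_xi ((measurable_EFinP _ _).1 mxi).
  rewrite moment_xi h2_xi0 xi0 !mulr0 cos0 divfK; last exact/eqP.
  set L := expR _ * _ => e; lra.
have {green_eta} : derive1 v t * eta tau0 omega0 t +
    v t * ((2 * tau0)^-1 * eta tau0 omega0 t -
       (- omega_radicand tau0 omega0 * xi tau0 omega0 t
              + (2 * tau0)^-1 * cos (omega tau0 omega0 * t))) = 0.
  apply: (mulfI exp_neq0); rewrite mulr0.
  have := green_eta ((measurable_EFinP _ _).1 meta).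
  rewrite moment_eta h1_eta0 !etaE xi0 !mulr0 cos0 divfK; last exact/eqP.
  set L := expR _ * _ => e; lra.
rewrite etaE; set c := cos _ in pyth *; set x := xi _ _ _ in pyth *.
set r := omega_radicand _ _ in pyth *; set k := (2 * tau0)^-1.
move=> e_eta e_xi; rewrite -[v t]mulr1 -pyth.
(* Cramer's rule: [v' t] cancels from [xi t] times the second equation minus
   [eta t] times the first one. *)
rewrite (_ : _ * _ = x * (derive1 v t * (c + k * x) +
    v t * (k * (c + k * x) - (- r * x + k * c)))
  - (c + k * x) * (derive1 v t * x + v t * (k * x - c))); last by ring.
by rewrite e_eta e_xi !mulr0 subr0.
Qed.
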